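(* Consider the one-dimensional ideal MHD system with source term, $\partial_t q+\partial_x f(q)=s$, discretized semi-discretely by a finite volume scheme with cell widths $\Delta x_i>0$. Suppose the source term is discretized so that it contributes to cell $i$ as $$s_i=\tfrac12\left(s_{i+\frac12}+s_{i-\frac12}\right),$$ where at each interface (with left state $L$ and right state $R$) $$s_{\rm interface}=-[\![B_1]\!]\left[0,0,0,0,0,\ \{\!\{u\}\!\}\frac{\{\!\{\beta\}\!\}\{\!\{B_1\}\!\}}{\{\!\{\Delta x\,\beta B_1\}\!\}},\ \{\!\{v\}\!\}\frac{\{\!\{\beta\}\!\}\{\!\{B_2\}\!\}}{\{\!\{\Delta x\,\beta B_2\}\!\}},\ \{\!\{w\}\!\}\frac{\{\!\{\beta\}\!\}\{\!\{B_3\}\!\}}{\{\!\{\Delta x\,\beta B_3\}\!\}}\right]^T .$$ Then the following numerical flux $\hat f^{\rm KEPEC}=(\hat f_1,\dots,\hat f_8)^T$ is a discretely entropy conservative and kinetic energy preserving numerical flux: $$\hat f_1=\rho^{\ln}\{\!\{u\}\!\},$$ $$\hat f_2=\rho^{\ln}\{\!\{u\}\!\}^2+\frac{\{\!\{\rho\}\!\}}{2\{\!\{\beta\}\!\}}+\tfrac12\left(\{\!\{B_1^2\}\!\}+\{\!\{B_2^2\}\!\}+\{\!\{B_3^2\}\!\}\right)-\{\!\{B_1^2\}\!\},$$ $$\hat f_3=\rho^{\ln}\{\!\{u\}\!\}\{\!\{v\}\!\}-\{\!\{B_1B_2\}\!\},\qquad \hat f_4=\rho^{\ln}\{\!\{u\}\!\}\{\!\{w\}\!\}-\{\!\{B_1B_3\}\!\},$$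 $$\begin{aligned}\hat f_5={}&\frac{\{\!\{u\}\!\}}{2}\left(\frac{\rho^{\ln}}{\beta^{\ln}(\gamma-1)}+\frac{\{\!\{\rho\}\!\}}{\{\!\{\beta\}\!\}}\right)+\frac{\rho^{\ln}\{\!\{u\}\!\}}{2}\left(2\left(\{\!\{u\}\!\}^2+\{\!\{v\}\!\}^2+\{\!\{w\}\!\}^2\right)-\left(\{\!\{u^2\}\!\}+\{\!\{v^2\}\!\}+\{\!\{w^2\}\!\}\right)\right)\\&+\frac{\{\!\{u\}\!\}}{2}\left(\{\!\{B_1^2\}\!\}+\{\!\{B_2^2\}\!\}+\{\!\{B_3^2\}\!\}+2\left[\{\!\{B_2\}\!\}^2+\{\!\{B_3\}\!\}^2\right]\right)-\{\!\{u\}\!\}\{\!\{B_1^2\}\!\}-\{\!\{v\}\!\}\{\!\{B_1B_2\}\!\}-\{\!\{w\}\!\}\{\!\{B_1B_3\}\!\}\\&-\{\!\{v\}\!\}\{\!\{B_1\}\!\}\{\!\{B_2\}\!\}-\{\!\{w\}\!\}\{\!\{B_1\}\!\}\{\!\{B_3\}\!\}+\{\!\{uB_1^2\}\!\}+\{\!\{vB_1B_2\}\!\}+\{\!\{wB_1B_3\}\!\}\\&-\tfrac12\left(\{\!\{uB_1^2\}\!\}+\{\!\{uB_2^2\}\!\}+\{\!\{uB_3^2\}\!\}\right),\end{aligned}$$ $$\hat f_6=0,\qquad \hat f_7=\{\!\{u\}\!\}\{\!\{B_2\}\!\}-\{\!\{v\}\!\}\{\!\{B_1\}\!\},\qquad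 \hat f_8=\{\!\{u\}\!\}\{\!\{B_3\}\!\}-\{\!\{w\}\!\}\{\!\{B_1\}\!\}.$$
   Context: States. A state is given by density $\rho>0$, velocity $\vec u=(u,v,w)$, pressure $p>0$ and magnetic field $\vec B=(B_1,B_2,B_3)$; $\gamma>1$ is constant. The conserved variables are $q=(\rho,\rho u,\rho v,\rho w,E,B_1,B_2,B_3)^T$ with $E=\frac{p}{\gamma-1}+\frac{\rho}{2}\|\vec u\|^2+\frac12\|\vec B\|^2$. The physical flux in the $x$-direction is $$f=\Big(\rho u,\ \rho u^2+p+\tfrac12\|\vec B\|^2-B_1^2,\ \rho uv-B_1B_2,\ \rho uw-B_1B_3,\ u\big(\tfrac{\rho}{2}\|\vec u\|^2+\tfrac{\gamma p}{\gamma-1}+\|\vec B\|^2\big)-B_1(\vec u\cdot\vec B),\ 0,\ uB_2-vB_1,\ uB_3-wB_1\Big)^T.$$ The source term being discretized is the Janhunen source $-(\partial_xB_1)(0,0,0,0,0,u,v,w)^T$. Entropy. Set $s(\rho,p)=\ln p-\gamma\ln\rho$ (the physical entropy, not the source), $S=-\frac{\rho s}{\gamma-1}$, $F=uS$, $\beta=\frac{\rho}{2p}$. The entropy variables are $$v=\partial S/\partial q=\Big(\tfrac{\gamma-s}{\gamma-1}-\beta\|\vec u\|^2,\ 2\beta u,\ 2\beta v,\ 2\beta w,\ -2\beta,\ 2\beta B_1,\ 2\beta B_2,\ 2\beta B_3\Big)^T.$$ Averages. At an interface with left and right states $L,R$ (and cell widths $\Delta x_L,\Delta x_R$): $[\![a]\!]=a_R-a_L$,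 $\{\!\{a\}\!\}=\frac12(a_L+a_R)$, and for positive $a$ the logarithmic mean is $a^{\ln}=\frac{a_L-a_R}{\ln a_L-\ln a_R}$ (equal to the common value if $a_L=a_R$). In $\{\!\{\Delta x\,\beta B_k\}\!\}$ the product $\Delta x\,\beta B_k$ is averaged. The denominators $\{\!\{\Delta x\,\beta B_k\}\!\}$, $k=1,2,3$, are assumed nonzero. Semi-discrete scheme at an interface with numerical flux $\hat f$ and interface source $s_{\rm interface}$: $$\Delta x_L\,\partial_tq_L=f_L-\hat f+\tfrac12\Delta x_L\,s_{\rm interface},\qquad \Delta x_R\,\partial_tq_R=\hat f-f_R+\tfrac12\Delta x_R\,s_{\rm interface}.$$ Definitions. A numerical flux $\hat f(q_L,q_R)$ is required to be consistent: $\hat f(q,q)=f(q)$. It is discretely entropy conservative (for the given source discretization) if for all admissible $L,R$ states and cell widths $$[\![v]\!]^T\hat f-[\![v\cdot f]\!]+\{\!\{\Delta x\,v\}\!\}^Ts_{\rm interface}=-[\![F]\!],$$ equivalently $\partial_t(\Delta x_LS_L+\Delta x_RS_R)=-[\![F]\!]$. It is kinetic energy preserving (in the sense of Jameson) if the momentum fluxes have the form $\hat f_2=\{\!\{u\}\!\}\hat f_1+g_1$, $\hat f_3=\{\!\{v\}\!\}\hat f_1+g_2$, $\hat f_4=\{\!\{w\}\!\}\hat f_1+g_3$, where $g_1,g_2,g_3$ depend only on the densities, pressures and magnetic fields of the two states and are consistent with $p+\frac12\|\vec B\|^2-B_1^2$, $-B_1B_2$, $-B_1B_3$ respectively. *)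

(* Defs.v *)
(* MathComp-Analysis; the reals are an arbitrary R : realType. *)
From HB Require Import structures.
From mathcomp Require Import all_boot all_order all_algebra.
From mathcomp Require Import all_classical all_reals all_analysis.

Set Implicit Arguments.
Unset Strict Implicit.
Unset Printing Implicit Defensive.

Import Order.TTheory GRing.Theory Num.Theory.
Import numFieldNormedType.Exports.

Local Open Scope ring_scope.

Record state (R : Type) := State {
  rho : R;
  ux : R; uy : R; uz : R;
  prs : R;
  B1 : R; B2 : R; B3 : R }.

Arguments rho {R}. Arguments ux {R}. Arguments uy {R}. Arguments uz {R}.
Arguments prs {R}. Arguments B1 {R}. Arguments B2 {R}. Arguments B3 {R}.

Section IdealMHD.
Context {R : realType}.
Implicit Types (q qL qR : state R) (gamma dxL dxR : R).

Definition admissible q := 0 < rho q /\ 0 < prs q.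

Definition vec8 (s : seq R) : 'rV[R]_8 := \row_(j < 8) s`_j.

Definition dot (x y : 'rV[R]_8) : R := \sum_(j < 8) x 0 j * y 0 j.

Definition usq q := ux q ^+ 2 + uy q ^+ 2 + uz q ^+ 2.
Definition Bsq q := B1 q ^+ 2 + B2 q ^+ 2 + B3 q ^+ 2.
Definition udotB q := ux q * B1 q + uy q * B2 q + uz q * B3 q.

Definition energy gamma q :=
  prs q / (gamma - 1) + rho q / 2 * usq q + Bsq q / 2.

Definition conserved gamma q : 'rV[R]_8 :=
  vec8 [:: rho q; rho q * ux q; rho q * uy q; rho q * uz q;
           energy gamma q; B1 q; B2 q; B3 q].

Definition flux gamma q : 'rV[R]_8 :=
  vec8 [:: rho q * ux q;
           rho q * ux q ^+ 2 + prs q + Bsq q / 2 - B1 q ^+ 2;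
           rho q * ux q * uy q - B1 q * B2 q;
           rho q * ux q * uz q - B1 q * B3 q;
           ux q * (rho q / 2 * usq q + gamma * prs q / (gamma - 1) + Bsq q)
             - B1 q * udotB q;
           0;
           ux q * B2 q - uy q * B1 q;
           ux q * B3 q - uz q * B1 q].

Definition phys_entropy gamma q := ln (prs q) - gamma * ln (rho q).
Definition entropy gamma q := - (rho q * phys_entropy gamma q / (gamma - 1)).
Definition entropy_flux gamma q := ux q * entropy gamma q.
Definition beta q := rho q / (2 * prs q).

Definition entropy_vars gamma q : 'rV[R]_8 :=
  vec8 [:: (gamma - phys_entropy gamma q) / (gamma - 1) - beta q * usq q;
           2 * beta q * ux q; 2 * beta q * uy q; 2 * beta q * uz q;
           - (2 * beta q);
           2 * beta q * B1 q; 2 * beta q * B2 q; 2 * beta q * B3 q].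

Definition jump {V : zmodType} (aL aR : V) : V := aR - aL.
Definition mean (aL aR : R) : R := (aL + aR) / 2.
Definition log_mean (aL aR : R) : R :=
  if aL == aR then aL else (aL - aR) / (ln aL - ln aR).

Definition numerical_flux := state R -> state R -> 'rV[R]_8.
(* Arguments: widths of the left and right cells, left and right states. *)
Definition interface_source := R -> R -> state R -> state R -> 'rV[R]_8.

(* The mean over both cells of Delta x * beta * B_k, for B_k = b. *)
Definition mean_dx_beta_B dxL dxR qL qR (b : state R -> R) :=
  mean (dxL * (beta qL * b qL)) (dxR * (beta qR * b qR)).

(* The last three conditions are the standing assumption that the denominators
   of the discretized source do not vanish. *)
Definition admissible_interface dxL dxR qL qR :=
  [/\ 0 < dxL, 0 < dxR, admissible qL, admissible qR &
   [/\ mean_dx_beta_B dxL dxR qL qR B1 != 0,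
       mean_dx_beta_B dxL dxR qL qR B2 != 0 &
       mean_dx_beta_B dxL dxR qL qR B3 != 0]].

(* The source s_i of cell i, from s_(i-1/2) and s_(i+1/2). *)
Definition cell_source (sl sr : 'rV[R]_8) : 'rV[R]_8 := 2^-1 *: (sr + sl).

(* Delta x_i d/dt q_i, from the numerical fluxes and the interface sources at
   i-1/2 (fl, sl) and i+1/2 (fr, sr). *)
Definition cell_rhs (dx : R) (fl fr sl sr : 'rV[R]_8) : 'rV[R]_8 :=
  fl - fr + dx *: cell_source sl sr.

(* The two cells next to an interface, updated by that interface alone: at its
   other face each cell sees its own physical flux and no source.  These are
   f_L - fhat + dxL/2 s_interface and fhat - f_R + dxR/2 s_interface. *)
Definition left_rhs gamma (src : interface_source) (fhat : numerical_flux)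
    dxL dxR qL qR :=
  cell_rhs dxL (flux gamma qL) (fhat qL qR) 0 (src dxL dxR qL qR).
Definition right_rhs gamma (src : interface_source) (fhat : numerical_flux)
    dxL dxR qL qR :=
  cell_rhs dxR (fhat qL qR) (flux gamma qR) (src dxL dxR qL qR) 0.

Definition consistent_flux gamma (fhat : numerical_flux) :=
  forall q, admissible q -> fhat q q = flux gamma q.

Definition entropy_conservative gamma (src : interface_source)
    (fhat : numerical_flux) :=
  forall dxL dxR qL qR, admissible_interface dxL dxR qL qR ->
    dot (jump (entropy_vars gamma qL) (entropy_vars gamma qR)) (fhat qL qR)
    - jump (dot (entropy_vars gamma qL) (flux gamma qL))
           (dot (entropy_vars gamma qR) (flux gamma qR))
    + dot (2^-1 *: (dxL *: entropy_vars gamma qL + dxR *: entropy_vars gamma qR))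
          (src dxL dxR qL qR)
    = - jump (entropy_flux gamma qL) (entropy_flux gamma qR).

(* The equivalent form in terms of the semi-discrete evolution:
   d/dt (dxL S_L + dxR S_R) = - [[F]]. *)
Definition entropy_rate_conservative gamma (src : interface_source)
    (fhat : numerical_flux) :=
  forall dxL dxR (yL yR : R -> state R) (t : R) (dqL dqR : 'rV[R]_8),
    admissible_interface dxL dxR (yL t) (yR t) ->
    (forall j, is_derive t 1 (fun x : R => conserved gamma (yL x) 0 j)
                 (dqL 0 j)) ->
    (forall j, is_derive t 1 (fun x : R => conserved gamma (yR x) 0 j)
                 (dqR 0 j)) ->
    dxL *: dqL = left_rhs gamma src fhat dxL dxR (yL t) (yR t) ->
    dxR *: dqR = right_rhs gamma src fhat dxL dxR (yL t) (yR t) ->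
    is_derive t 1
      (fun x : R => dxL * entropy gamma (yL x) + dxR * entropy gamma (yR x))
      (- jump (entropy_flux gamma (yL t)) (entropy_flux gamma (yR t))).

(* Everything in a state except the velocity. *)
Definition static_part q := (rho q, prs q, (B1 q, B2 q, B3 q)).

(* Components are numbered from 0: the mass flux is component 0, the momentum
   fluxes are components 1, 2, 3. *)
Definition kinetic_energy_preserving (fhat : numerical_flux) :=
  exists g1 g2 g3 : R * R * (R * R * R) -> R * R * (R * R * R) -> R,
    [/\ forall q, admissible q ->
          [/\ g1 (static_part q) (static_part q)
                = prs q + Bsq q / 2 - B1 q ^+ 2,
              g2 (static_part q) (static_part q) = - (B1 q * B2 q) &
              g3 (static_part q) (static_part q) = - (B1 q * B3 q)] &
        forall qL qR, admissible qL -> admissible qR ->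
          [/\ fhat qL qR 0 (inord 1) = mean (ux qL) (ux qR) * fhat qL qR 0 (inord 0)
                + g1 (static_part qL) (static_part qR),
              fhat qL qR 0 (inord 2) = mean (uy qL) (uy qR) * fhat qL qR 0 (inord 0)
                + g2 (static_part qL) (static_part qR) &
              fhat qL qR 0 (inord 3) = mean (uz qL) (uz qR) * fhat qL qR 0 (inord 0)
                + g3 (static_part qL) (static_part qR)]].

Definition janhunen_source : interface_source := fun dxL dxR qL qR =>
  let m (a : state R -> R) := mean (a qL) (a qR) in
  let d := mean_dx_beta_B dxL dxR qL qR in
  - jump (B1 qL) (B1 qR) *:
  vec8 [:: 0; 0; 0; 0; 0;
           m ux * (m beta * m B1 / d B1);
           m uy * (m beta * m B2 / d B2);
           m uz * (m beta * m B3 / d B3)].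

Definition kepec_flux gamma : numerical_flux := fun qL qR =>
  let m (a : state R -> R) := mean (a qL) (a qR) in
  let rho_ln := log_mean (rho qL) (rho qR) in
  let beta_ln := log_mean (beta qL) (beta qR) in
  let mB1B1 := m (fun q => B1 q ^+ 2) in
  let mB2B2 := m (fun q => B2 q ^+ 2) in
  let mB3B3 := m (fun q => B3 q ^+ 2) in
  let mB1B2 := m (fun q => B1 q * B2 q) in
  let mB1B3 := m (fun q => B1 q * B3 q) in
  vec8 [::
    rho_ln * m ux;
    rho_ln * m ux ^+ 2 + m rho / (2 * m beta)
      + 2^-1 * (mB1B1 + mB2B2 + mB3B3) - mB1B1;
    rho_ln * m ux * m uy - mB1B2;
    rho_ln * m ux * m uz - mB1B3;
    m ux / 2 * (rho_ln / (beta_ln * (gamma - 1)) + m rho / m beta)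
      + rho_ln * m ux / 2
        * (2 * (m ux ^+ 2 + m uy ^+ 2 + m uz ^+ 2)
           - (m (fun q => ux q ^+ 2) + m (fun q => uy q ^+ 2)
              + m (fun q => uz q ^+ 2)))
      + m ux / 2
        * (mB1B1 + mB2B2 + mB3B3 + 2 * (m B2 ^+ 2 + m B3 ^+ 2))
      - m ux * mB1B1 - m uy * mB1B2 - m uz * mB1B3
      - m uy * m B1 * m B2 - m uz * m B1 * m B3
      + m (fun q => ux q * B1 q ^+ 2)
      + m (fun q => uy q * B1 q * B2 q)
      + m (fun q => uz q * B1 q * B3 q)
      - 2^-1 * (m (fun q => ux q * B1 q ^+ 2) + m (fun q => ux q * B2 q ^+ 2)
                + m (fun q => ux q * B3 q ^+ 2));
    0;
    m ux * m B2 - m uy * m B1;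
    m ux * m B3 - m uz * m B1].

End IdealMHD.

(* Main.v *)
Require Import Defs.
From mathcomp Require Import all_boot all_order all_algebra.
From mathcomp Require Import all_classical all_reals all_analysis.
From mathcomp Require Import ring.
Import Order.TTheory GRing.Theory Num.Theory.
Import numFieldNormedType.Exports.
Local Open Scope ring_scope.

Set Implicit Arguments.
Unset Strict Implicit.
Unset Printing Implicit Defensive.

(** Entropy conservation is reduced to a Tadmor-type condition on jumps.  For
    the present system the product v.f is not F plus the mass flux, as it is
    for the Euler equations, but F plus the potential
      psi = rho u + beta (u |B|^2 - 2 B1 (u.B))
    ([dot_entropy_vars_flux]), so that the flux has to satisfy
      [[v]].fhat + {{dx v}}.s = [[psi]].
    The source is divided by the means {{dx beta B_k}} precisely so that these
    cancel against {{dx v_(5+k)}} = 2 {{dx beta B_k}}: its contribution does not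
    depend on the cell widths any more ([dot_janhunen_source]).

    The only transcendental ingredient of [[v]] is the jump of the physical
    entropy.  Written in terms of rho and beta instead of rho and p, it is a
    combination of [[ln rho]] and [[ln beta]], and the logarithmic mean is
    defined so that [[ln a]] = [[a]] / a^ln ([jump_ln]).  After this the
    condition on jumps is an identity between rational functions of the left
    and right values and of the two logarithmic means
    ([kepec_jump_condition]).

    The evolutionary form follows for any flux and source from the chain rule
    dS/dt = v . dq/dt ([is_derive_entropy]): multiplied by the cell widths, the
    two scheme equations add up to the left-hand side of the algebraic
    condition ([entropy_conservative_rate]).  The chain rule needs some care
    because only the conserved variables are known to be differentiable: the
    velocities are recovered by division by rho, which does not vanish near the
    given time, and then p is recovered from the energy.

    Consistency and preservation of kinetic energy are read off the formulas,
    since all means of equal arguments are the common value and since beta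
    depends on rho and p only. *)

(** * The pairing of rows *)

Lemma dot_vec8 (R : realType) (a0 a1 a2 a3 a4 a5 a6 a7 : R) (y : 'rV[R]_8) :
  dot (vec8 [:: a0; a1; a2; a3; a4; a5; a6; a7]) y =
  a0 * y 0 (inord 0) + a1 * y 0 (inord 1) + a2 * y 0 (inord 2)
  + a3 * y 0 (inord 3) + a4 * y 0 (inord 4) + a5 * y 0 (inord 5)
  + a6 * y 0 (inord 6) + a7 * y 0 (inord 7).
Proof.
pose F j := [:: a0; a1; a2; a3; a4; a5; a6; a7]`_j * y 0 (inord j).
rewrite /dot (eq_bigr (fun j : 'I_8 => F j)); last first.
  by move=> j _; rewrite mxE /F inord_val.
by rewrite -(big_mkord xpredT F) unlock /= addr0 !addrA.
Qed.

Lemma dotDl (R : realType) (x y z : 'rV[R]_8) :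
  dot (x + y) z = dot x z + dot y z.
Proof.
by rewrite /dot -big_split; apply: eq_bigr => j _; rewrite mxE mulrDl.
Qed.

Lemma dotDr (R : realType) (x y z : 'rV[R]_8) :
  dot x (y + z) = dot x y + dot x z.
Proof.
by rewrite /dot -big_split; apply: eq_bigr => j _; rewrite mxE mulrDr.
Qed.

Lemma dotZl (R : realType) (k : R) (x y : 'rV[R]_8) :
  dot (k *: x) y = k * dot x y.
Proof. by rewrite /dot mulr_sumr; apply: eq_bigr => j _; rewrite mxE mulrA. Qed.

Lemma dotZr (R : realType) (k : R) (x y : 'rV[R]_8) :
  dot x (k *: y) = k * dot x y.
Proof. by rewrite /dot mulr_sumr; apply: eq_bigr => j _; rewrite mxE mulrCA. Qed.

Lemma dotBl (R : realType) (x y z : 'rV[R]_8) :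
  dot (x - y) z = dot x z - dot y z.
Proof. by rewrite -scaleN1r dotDl dotZl mulN1r. Qed.

Lemma dotBr (R : realType) (x y z : 'rV[R]_8) :
  dot x (y - z) = dot x y - dot x z.
Proof. by rewrite -scaleN1r dotDr dotZr mulN1r. Qed.

(** * Means *)

Lemma mean_id (R : realType) (a : R) : mean a a = a.
Proof. by rewrite /mean; field. Qed.

Lemma log_mean_id (R : realType) (a : R) : log_mean a a = a.
Proof. by rewrite /log_mean eqxx. Qed.

Lemma log_mean_neq0 (R : realType) (a b : R) :
  0 < a -> 0 < b -> log_mean a b != 0.
Proof.
move=> a0 b0; rewrite /log_mean; case: (eqVneq a b) => [_|ab].
  by rewrite gt_eqF.
rewrite mulf_neq0 ?invr_eq0 ?subr_eq0 //.
by apply: contra ab => /eqP /ln_inj -> //; rewrite posrE.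
Qed.

Lemma jump_ln (R : realType) (a b : R) :
  0 < a -> 0 < b -> ln b - ln a = (b - a) / log_mean a b.
Proof.
move=> a0 b0; rewrite /log_mean; case: (eqVneq a b) => [->|ab].
  by rewrite !subrr mul0r.
have lab : ln a - ln b != 0.
  rewrite subr_eq0.
  by apply: contra ab => /eqP /ln_inj -> //; rewrite posrE.
have dab : a - b != 0 by rewrite subr_eq0.
by field; rewrite lab dab.
Qed.

(** * Entropy in the variables rho and beta *)

Lemma beta_gt0 (R : realType) (q : state R) : admissible q -> 0 < beta q.
Proof. by case=> r0 p0; rewrite divr_gt0 ?mulr_gt0. Qed.

Lemma prs_beta (R : realType) (q : state R) : admissible q ->
  prs q = rho q / (2 * beta q).
Proof. by case=> r0 p0; rewrite /beta; field; rewrite !gt_eqF. Qed.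

Lemma phys_entropy_beta (R : realType) (gamma : R) (q : state R) :
  admissible q ->
  phys_entropy gamma q = (1 - gamma) * ln (rho q) - ln (beta q) - ln 2.
Proof.
move=> aq; have b0 := beta_gt0 aq; case: (aq) => r0 _.
have p2 : (2 : R) \is Num.pos by rewrite posrE.
have pb : beta q \is Num.pos by rewrite posrE.
have p2b : 2 * beta q \is Num.pos by rewrite posrE mulr_gt0.
by rewrite /phys_entropy (prs_beta aq) ln_div // lnM //; ring.
Qed.

(** The difference v.f - F.  For an entropy pair compatible with the flux its
    derivative with respect to v would be f; here v.df - dF is not zero but a
    multiple of dB1, which is what the source compensates. *)
Definition entropy_potential (R : realType) (q : state R) : R :=
  rho q * ux q + beta q * (ux q * Bsq q - 2 * B1 q * udotB q).

Lemma dot_entropy_vars_flux (R : realType) (gamma : R) (q : state R) :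
  gamma != 1 -> admissible q ->
  dot (entropy_vars gamma q) (flux gamma q) =
  entropy_flux gamma q + entropy_potential q.
Proof.
move=> g1 [r0 p0]; rewrite dot_vec8 !mxE !inordK //=.
rewrite /entropy_potential /entropy_flux /entropy /beta /Bsq /usq /udotB.
by field; rewrite subr_eq0 g1 gt_eqF.
Qed.

(** * Entropy conservation at an interface *)

(** The denominators of the source are exactly half the components of
    {{dx v}} that it is paired with, so the result is free of cell widths. *)
Lemma dot_janhunen_source (R : realType) (gamma dxL dxR : R)
    (qL qR : state R) :
  admissible_interface dxL dxR qL qR ->
  dot (2^-1 *: (dxL *: entropy_vars gamma qL + dxR *: entropy_vars gamma qR))
      (janhunen_source dxL dxR qL qR)
  = - (2 * jump (B1 qL) (B1 qR) * mean (beta qL) (beta qR) *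
       (mean (ux qL) (ux qR) * mean (B1 qL) (B1 qR)
        + mean (uy qL) (uy qR) * mean (B2 qL) (B2 qR)
        + mean (uz qL) (uz qR) * mean (B3 qL) (B3 qR))).
Proof.
case=> _ _ _ _ [d1 d2 d3].
rewrite dotZl dotDl !dotZl !dot_vec8 !mxE !inordK //= !mulr0.
move: d1 d2 d3; rewrite /mean_dx_beta_B /jump /mean.
move: (beta qL) (beta qR) => betaL betaR.
rewrite !mulf_eq0 !negb_or => /andP[d1 _] /andP[d2 _] /andP[d3 _].
by field; rewrite d1 d2 d3.
Qed.

(** Once [[ln rho]] and [[ln beta]] are expressed by logarithmic means, this is
    an identity of rational functions in which beta on both sides and the two
    logarithmic means are independent variables. *)
Lemma kepec_jump_condition (R : realType) (gamma : R) (qL qR : state R) :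
  gamma != 1 -> admissible qL -> admissible qR ->
  dot (jump (entropy_vars gamma qL) (entropy_vars gamma qR))
      (kepec_flux gamma qL qR)
  - 2 * jump (B1 qL) (B1 qR) * mean (beta qL) (beta qR) *
       (mean (ux qL) (ux qR) * mean (B1 qL) (B1 qR)
        + mean (uy qL) (uy qR) * mean (B2 qL) (B2 qR)
        + mean (uz qL) (uz qR) * mean (B3 qL) (B3 qR))
  = jump (entropy_potential qL) (entropy_potential qR).
Proof.
move=> g1 aL aR.
have bL := beta_gt0 aL; have bR := beta_gt0 aR.
have [rL _] := aL; have [rR _] := aR.
have lr := log_mean_neq0 rL rR; have lb := log_mean_neq0 bL bR.
have g1' : gamma - 1 != 0 by rewrite subr_eq0.
have mb : beta qL + beta qR != 0 by rewrite gt_eqF ?addr_gt0.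
have lrE : ln (rho qR) =
    ln (rho qL) + (rho qR - rho qL) / log_mean (rho qL) (rho qR).
  by rewrite -jump_ln // addrC subrK.
have lbE : ln (beta qR) =
    ln (beta qL) + (beta qR - beta qL) / log_mean (beta qL) (beta qR).
  by rewrite -jump_ln // addrC subrK.
rewrite /jump dotBl !dot_vec8 !mxE !inordK //=.
rewrite !phys_entropy_beta // lrE lbE.
rewrite /entropy_potential /udotB /usq /Bsq /mean.
move: (beta qL) (beta qR) (log_mean (rho _) _) (log_mean (beta _) _)
  lr lb mb {lrE lbE bL bR}.
move=> betaL betaR rln bln lr lb mb.
by field; rewrite mb g1' lb lr.
Qed.

Lemma kepec_entropy_conservative (R : realType) (gamma : R) :
  gamma != 1 ->
  entropy_conservative gamma janhunen_source (kepec_flux gamma).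
Proof.
move=> g1 dxL dxR qL qR adm; have [_ _ aL aR _] := adm.
rewrite dot_janhunen_source // !dot_entropy_vars_flux //.
have := kepec_jump_condition g1 aL aR; rewrite /jump => /eqP.
by rewrite subr_eq => /eqP ->; ring.
Qed.

(** * The chain rule for the entropy *)

(** Near t the function m is the quotient of r m by r, hence differentiable. *)
Lemma is_derive_cofactor (R : realType) (r m : R -> R) (t dr dm : R) :
  r t != 0 -> is_derive t 1 r dr -> is_derive t 1 (fun x => r x * m x) dm ->
  is_derive t 1 m ((dm - m t * dr) / r t).
Proof.
move=> rt0 hr hm.
have rnz : \forall x \near t, r x != 0.
  have cr : {for t, continuous r}.
    by apply/differentiable_continuous/derivable1_diffP; case: hr.
  exact: (cvgr_neq0 _ cr rt0).
apply: (@near_eq_is_derive _ _ _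
    ((fun x => r x * m x) * (fun x => (r x)^-1))).
  near=> x; have rx : r x != 0 by near: x.
  by rewrite /GRing.mul /= mulrAC divff // mul1r.
apply: is_derive_eq (is_deriveM hm (is_deriveV rt0 hr)) _.
by rewrite /GRing.scale /=; field.
Unshelve. all: by end_near. Qed.

Lemma is_derive_entropy (R : realType) (gamma : R) (y : R -> state R) (t : R)
    (dq : 'rV[R]_8) :
  gamma != 1 -> admissible (y t) ->
  (forall j, is_derive t 1 (fun x => conserved gamma (y x) 0 j) (dq 0 j)) ->
  is_derive t 1 (fun x => entropy gamma (y x))
    (dot (entropy_vars gamma (y t)) dq).
Proof.
move=> g1 [r0 p0] h.
have g1' : gamma - 1 != 0 by rewrite subr_eq0.
have rt : rho (y t) != 0 by rewrite gt_eqF.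
have pt : prs (y t) != 0 by rewrite gt_eqF.
have comp k (f : R -> R) :
    (forall x, conserved gamma (y x) 0 (inord k) = f x) ->
    is_derive t 1 f (dq 0 (inord k)).
  by move=> /funext <-.
have hr : is_derive t 1 (fun x => rho (y x)) (dq 0 (inord 0)).
  by apply: comp => x; rewrite mxE inordK.
have hu : is_derive t 1 (fun x => rho (y x) * ux (y x)) (dq 0 (inord 1)).
  by apply: comp => x; rewrite mxE inordK.
have hv : is_derive t 1 (fun x => rho (y x) * uy (y x)) (dq 0 (inord 2)).
  by apply: comp => x; rewrite mxE inordK.
have hw : is_derive t 1 (fun x => rho (y x) * uz (y x)) (dq 0 (inord 3)).
  by apply: comp => x; rewrite mxE inordK.
have hE : is_derive t 1 (fun x => energy gamma (y x)) (dq 0 (inord 4)).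
  by apply: comp => x; rewrite mxE inordK.
have hB1 : is_derive t 1 (fun x => B1 (y x)) (dq 0 (inord 5)).
  by apply: comp => x; rewrite mxE inordK.
have hB2 : is_derive t 1 (fun x => B2 (y x)) (dq 0 (inord 6)).
  by apply: comp => x; rewrite mxE inordK.
have hB3 : is_derive t 1 (fun x => B3 (y x)) (dq 0 (inord 7)).
  by apply: comp => x; rewrite mxE inordK.
have {}hu := is_derive_cofactor rt hr hu.
have {}hv := is_derive_cofactor rt hr hv.
have {}hw := is_derive_cofactor rt hr hw.
have husq : is_derive t 1 (fun x => usq (y x)) _ :=
  is_deriveD (is_deriveD (is_deriveX 2 hu) (is_deriveX 2 hv))
             (is_deriveX 2 hw).
have hBsq : is_derive t 1 (fun x => Bsq (y x)) _ :=
  is_deriveD (is_deriveD (is_deriveX 2 hB1) (is_deriveX 2 hB2))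
             (is_deriveX 2 hB3).
have prsE x : prs (y x) =
    (gamma - 1) * (energy gamma (y x) - 2^-1 * (rho (y x) * usq (y x))
                   - 2^-1 * Bsq (y x)).
  by rewrite /energy; field.
have hp : is_derive t 1 (fun x => (gamma - 1) *
    (energy gamma (y x) - 2^-1 * (rho (y x) * usq (y x))
     - 2^-1 * Bsq (y x))) _ :=
  is_deriveZ (gamma - 1) (is_deriveB (is_deriveB hE
    (is_deriveZ 2^-1 (is_deriveM hr husq))) (is_deriveZ 2^-1 hBsq)).
rewrite -(funext prsE) in hp.
have hlnr : is_derive t 1 (fun x => ln (rho (y x))) _ :=
  is_derive1_comp (is_derive1_ln r0) hr.
have hlnp : is_derive t 1 (fun x => ln (prs (y x))) _ :=
  is_derive1_comp (is_derive1_ln p0) hp.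
have hs : is_derive t 1 (fun x => phys_entropy gamma (y x)) _ :=
  is_deriveB hlnp (is_deriveZ gamma hlnr).
have entropyE x : entropy gamma (y x) =
    - (gamma - 1)^-1 * (rho (y x) * phys_entropy gamma (y x)).
  by rewrite /entropy mulNr mulrC.
rewrite (funext entropyE).
apply: is_derive_eq (is_deriveZ (- (gamma - 1)^-1) (is_deriveM hr hs)) _.
rewrite dot_vec8 /GRing.scale /= /beta /usq /phys_entropy.
by field; rewrite pt g1' rt.
Qed.

(** Each cell receives one half of the interface source, so pairing the two
    scheme equations with vL and vR produces {{dx v}}.s and, from the flux,
    [[v]].fhat - [[v.f]]. *)
Lemma entropy_conservative_rate (R : realType) (gamma : R)
    (src : interface_source) (fhat : numerical_flux (R := R)) :
  gamma != 1 -> entropy_conservative gamma src fhat ->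
  entropy_rate_conservative gamma src fhat.
Proof.
move=> g1 cons dxL dxR yL yR t dqL dqR adm hL hR eL eR.
have [_ _ aL aR _] := adm.
have hS := is_deriveD (is_deriveZ dxL (is_derive_entropy g1 aL hL))
                      (is_deriveZ dxR (is_derive_entropy g1 aR hR)).
apply: is_derive_eq hS _.
rewrite -(cons _ _ _ _ adm) /GRing.scale /= -!dotZr eL eR.
rewrite /left_rhs /right_rhs /cell_rhs /cell_source addr0 add0r /jump.
rewrite !(dotBr, dotBl, dotDr, dotDl, dotZr, dotZl).
by field.
Qed.

(** * Consistency and kinetic energy *)

Lemma kepec_consistent (R : realType) (gamma : R) :
  gamma != 1 -> consistent_flux gamma (kepec_flux gamma).
Proof.
move=> g1 q [r0 p0].
have g1' : gamma - 1 != 0 by rewrite subr_eq0.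
have rn : rho q != 0 by rewrite gt_eqF.
have pn : prs q != 0 by rewrite gt_eqF.
rewrite /kepec_flux /flux !mean_id !log_mean_id /beta /usq /Bsq /udotB.
congr (vec8 [:: _; _; _; _; _; _; _; _]); try by ring.
- by field; rewrite rn pn.
- by field; rewrite g1' rn pn.
Qed.

Lemma kepec_kinetic_energy_preserving (R : realType) (gamma : R) :
  kinetic_energy_preserving (kepec_flux gamma).
Proof.
(* beta, written as a function of the static part of a state *)
pose b (s : R * R * (R * R * R)) := s.1.1 / (2 * s.1.2).
pose b1 (s : R * R * (R * R * R)) := s.2.1.1.
pose b2 (s : R * R * (R * R * R)) := s.2.1.2.
pose b3 (s : R * R * (R * R * R)) := s.2.2.
exists (fun s s' =>
  mean s.1.1 s'.1.1 / (2 * mean (b s) (b s'))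
  + 2^-1 * (mean (b1 s ^+ 2) (b1 s' ^+ 2) + mean (b2 s ^+ 2) (b2 s' ^+ 2)
            + mean (b3 s ^+ 2) (b3 s' ^+ 2))
  - mean (b1 s ^+ 2) (b1 s' ^+ 2)).
exists (fun s s' => - mean (b1 s * b2 s) (b1 s' * b2 s')).
exists (fun s s' => - mean (b1 s * b3 s) (b1 s' * b3 s')).
split=> [q [r0 p0]|qL qR _ _].
  rewrite /b /b1 /b2 /b3 /= !mean_id; split=> //.
  by rewrite /Bsq; field; rewrite !gt_eqF.
rewrite !mxE !inordK //= /b /b1 /b2 /b3 /= -!/(beta _).
by split; ring.
Qed.

Theorem theorem1 (R : realType) (gamma : R) (hgamma : 1 < gamma) :
  [/\ consistent_flux gamma (kepec_flux gamma),
      entropy_conservative gamma janhunen_source (kepec_flux gamma),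
      entropy_rate_conservative gamma janhunen_source (kepec_flux gamma) &
      kinetic_energy_preserving (kepec_flux gamma)].
Proof.
have g1 : gamma != 1 by rewrite gt_eqF.
have cons := kepec_entropy_conservative g1.
split=> //.
- exact: kepec_consistent.
- exact: entropy_conservative_rate.
- exact: kepec_kinetic_energy_preserving.
Qed.
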